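(* Fix $\rho\in(0,1)$. For each $n$ let $X=(X_1,\dots,X_n)'$ be jointly normal with $E[X_i]=0$, $E[X_i^2]=1$ and $\operatorname{Corr}(X_i,X_j)=\rho$ for $i\neq j$, and let $M_n(X)=\max(X_1,\dots,X_n)$. Let $\widehat\rho=\widehat\rho_n$ be an estimator (a measurable function of $X$ with values in $[0,1)$) satisfying $\sqrt{2\ln n}\,\big(\sqrt{1-\rho}-\sqrt{1-\widehat\rho}\big)\xrightarrow{P}0$. Then $$\left|\int_{-\infty}^{\infty}\left(\Phi^n\!\left(\frac{x\sqrt{\rho}+M_n(X)}{\sqrt{1-\rho}}\right)-\Phi^n\!\left(\frac{x\sqrt{\widehat\rho}+M_n(X)}{\sqrt{1-\widehat\rho}}\right)\right)\phi(x)\,dx\right|\xrightarrow[n\to\infty]{P}0,$$ so that the one-sided $p$-value $1-\int\Phi^n\big((x\sqrt{r}+M_n(X))/\sqrt{1-r}\big)\phi(x)dx$ evaluated at $r=\widehat\rho$ minus the same quantity at $r=\rho$ converges to $0$ in probability.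
   Context: $\Phi$ and $\phi$ denote the standard normal cumulative distribution function and density; $\Phi^n$ is the $n$-th power of $\Phi$. The correlation $\rho$ does not depend on $n$. *)

(* Defs.v *)
From HB Require Import structures.
From mathcomp Require Import all_boot all_order all_algebra.
From mathcomp Require Import all_classical all_reals all_analysis.
Set Implicit Arguments. Unset Strict Implicit. Unset Printing Implicit Defensive.
Import Order.TTheory GRing.Theory Num.Theory.
Import numFieldNormedType.Exports.
Local Open Scope classical_set_scope.
Local Open Scope ring_scope.

Definition std_phi {R : realType} (x : R) : R := normal_pdf 0 1 x.
Definition std_Phi {R : realType} (x : R) : R :=
  fine (normal_prob 0 1 `]-oo, x]).

(* maximum of a finite family x_0, ..., x_{n-1} (meaningful for n >= 1) *)
Definition Mn {R : realType} (n : nat) (x : 'I_n -> R) : R :=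
  fine (\big[Order.max/-oo%E]_(i < n) (x i)%:E).

(* Law of a real random variable Y is N(0, v), v >= 0
   (v = 0 : the degenerate law concentrated at 0). *)
Definition centered_normal_law d (T : measurableType d) (R : realType)
  (P : probability T R) (Y : T -> R) (v : R) : Prop :=
  forall A : set R, measurable A ->
    P (Y @^-1` A) =
      (if v == 0 then (\1_A (0 : R))%:E else normal_prob 0 (Num.sqrt v) A).

Definition jointly_normal0 d (T : measurableType d) (R : realType)
  (P : probability T R) (n : nat) (X : 'I_n -> T -> R)
  (S : 'I_n -> 'I_n -> R) : Prop :=
  forall a : 'I_n -> R,
    centered_normal_law P (fun w => \sum_(i < n) a i * X i w)
      (\sum_(i < n) \sum_(j < n) a i * S i j * a j).

Definition equicorr {R : realType} {n : nat} (rho : R) : 'I_n -> 'I_n -> R :=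
  fun i j => if i == j then 1 else rho.

Definition cvg_prob0 d (T : measurableType d) (R : realType)
  (P : probability T R) (Y : nat -> T -> R) : Prop :=
  forall eps : R, 0 < eps ->
    (P [set w | eps < `|Y n w|]) @[n --> \oo] --> 0%E.

(* Main.v *)
Require Import Defs.
From HB Require Import structures.
From mathcomp Require Import all_boot all_order all_algebra.
From mathcomp Require Import all_classical all_reals all_analysis.
From mathcomp Require Import measurable_realfun ring lra.
Import Order.TTheory GRing.Theory Num.Theory.
Import numFieldNormedType.Exports.
Local Open Scope classical_set_scope.
Local Open Scope ring_scope.

(** With [b_n = sqrt (2 ln n)], the function [Phi^n] is nearly a unit step at
    [b_n]: it tends to 0 at [b_n - t] and to 1 at [b_n + t] for every fixed
    [t > 0]. Hence the integral with parameters [a = sqrt r], [b = sqrt (1 - r)]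
    and maximum [m] is nearly [1 - Phi ((b * b_n - m) / a)]. When [b_n (b - b')]
    and [a - a'] are small, the points [(b * b_n - m) / a] and
    [(b' * b_n - m) / a'] differ by a small shift and a scaling close to 1, which
    changes [Phi] by a small amount uniformly in [m]. *)

(** * Bounds on the standard normal distribution function *)

Section std_normal.
Set Implicit Arguments.
Unset Strict Implicit.
Context {R : realType}.
Implicit Types (u x y s a t e m : R) (n : nat).
Local Notation mu := (@lebesgue_measure R).
Local Notation N01 := (@normal_prob R 0 1).
Local Notation peak := (@normal_peak R 1).

Lemma std_phiE x : std_phi x = peak * expR (- x ^+ 2 / 2).
Proof.
by rewrite /std_phi normal_pdfE ?oner_neq0// /normal_fun subr0 expr1n.
Qed.

Lemma std_phi_ge0 x : 0 <= std_phi x.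
Proof. exact: normal_pdf_ge0. Qed.

Lemma integrable_std_phi : mu.-integrable setT (EFin \o (@std_phi R)).
Proof. exact: integrable_normal_pdf. Qed.

Lemma peak_gt0 : 0 < peak.
Proof. by rewrite normal_peak_gt0// oner_neq0. Qed.

Lemma std_Phi_ge0 x : 0 <= std_Phi x.
Proof. exact/fine_ge0. Qed.

Lemma std_Phi_le1 x : std_Phi x <= 1.
Proof.
by rewrite -lee_fin fineK ?fin_num_measure//; exact: probability_le1.
Qed.

Lemma std_PhiB x y : x <= y -> std_Phi y - std_Phi x = fine (N01 `]x, y]).
Proof.
move=> xy; apply/eqP; rewrite subr_eq addrC; apply/eqP.
rewrite /std_Phi -fineD ?fin_num_measure//; congr fine.
rewrite -measureU//; last first.
  apply/seteqP; split => // z [] /=; rewrite !in_itv/= => zx /andP[xz _].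
  by move: (lt_le_trans xz zx); rewrite ltxx.
by rewrite -itv_bndbnd_setU.
Qed.

Lemma std_Phi_le x y : x <= y -> std_Phi x <= std_Phi y.
Proof. by move=> xy; rewrite -subr_ge0 std_PhiB//; exact: fine_ge0. Qed.

Lemma onem_std_Phi x : 1 - std_Phi x = fine (N01 `]x, +oo[).
Proof.
rewrite -setCitvl probability_setC//.
by rewrite fineB ?fin_num_measure.
Qed.

Lemma std_PhiB_ub x y : x <= y -> std_Phi y - std_Phi x <= (y - x) * peak.
Proof.
move=> xy; rewrite std_PhiB// -lee_fin fineK ?fin_num_measure//.
rewrite /normal_prob.
apply: (@le_trans _ _ (\int[mu]_(z in `]x, y]) (cst peak%:E z))%E).
  apply: ge0_le_integral => //=.
  - by move=> z _; rewrite lee_fin normal_pdf_ge0.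
  - by apply: measurable_funTS; apply/measurable_EFinP; exact: measurable_normal_pdf.
  - by move=> z _; rewrite lee_fin normal_pdf_ub// oner_neq0.
rewrite integral_cst//= lebesgue_measure_itv/= lte_fin.
have [xy'|yx] := ltP x y; first by rewrite -EFinB -EFinM mulrC.
by rewrite mule0 lee_fin mulr_ge0 ?subr_ge0// normal_peak_ge0.
Qed.

(** The density decreases on the nonnegative half-line, so on []x, y]] it is at least its value at
    [y]. *)
Lemma std_PhiB_lb x y : 0 <= x <= y -> (y - x) * std_phi y <= std_Phi y - std_Phi x.
Proof.
move=> /andP[x0 xy]; rewrite std_PhiB// -lee_fin fineK ?fin_num_measure//.
rewrite /normal_prob.
apply: (@le_trans _ _ (\int[mu]_(z in `]x, y]) (cst (std_phi y)%:E z))%E).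
  rewrite integral_cst//= lebesgue_measure_itv/= lte_fin.
  have [xy'|yx] := ltP x y; first by rewrite -EFinB -EFinM mulrC.
  by rewrite mule0 lee_fin mulr_le0_ge0 ?subr_le0// std_phi_ge0.
apply: ge0_le_integral => //=.
- by move=> z _; rewrite lee_fin normal_pdf_ge0.
- by apply: measurable_funTS; apply/measurable_EFinP; exact: measurable_normal_pdf.
- move=> z; rewrite in_itv/= => /andP[xz zy].
  rewrite lee_fin -/(std_phi z) !std_phiE ler_pM2l ?peak_gt0//.
  rewrite ler_expR; have z0 : 0 <= z by rewrite (le_trans x0)// ltW.
  nra.
Qed.

(* [x * u >= u ^+ 2] gives [x ^+ 2 >= u ^+ 2 + (x - u) ^+ 2], so the density is at
   most [expR (- u ^+ 2 / 2)] times that of the normal law centred at [u]. *)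
Lemma normal_prob_tail (A : set R) u : measurable A ->
  (forall x, A x -> u ^+ 2 <= x * u) -> fine (N01 A) <= expR (- u ^+ 2 / 2).
Proof.
move=> mA Au; rewrite -lee_fin fineK ?fin_num_measure//.
rewrite /normal_prob.
pose c := expR (- u ^+ 2 / 2).
apply: (@le_trans _ _ (\int[mu]_(x in A) (c%:E * (normal_pdf u 1 x)%:E))%E).
  apply: ge0_le_integral => //=.
  - by move=> z _; rewrite lee_fin normal_pdf_ge0.
  - by apply: measurable_funTS; apply/measurable_EFinP; exact: measurable_normal_pdf.
  - apply: measurable_funTS; apply/measurable_EFinP; apply: measurable_funM => //.
    exact: measurable_normal_pdf.
  - move=> x /Au ux; rewrite -EFinM lee_fin !normal_pdfE ?oner_neq0//.
    rewrite mulrCA ler_pM2l ?peak_gt0// /normal_fun /c -expRD ler_expR.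
    rewrite subr0 expr1n; lra.
rewrite ge0_integralZl//=; first last.
- by rewrite lee_fin expR_ge0.
- by move=> x _; rewrite lee_fin normal_pdf_ge0.
- by apply: measurable_funTS; apply/measurable_EFinP; exact: measurable_normal_pdf.
rewrite -[leRHS]mule1 lee_pmul2l ?lte_fin ?expR_gt0//.
exact: (@probability_le1 _ _ _ (normal_prob u 1)).
Qed.

Lemma std_Phi_upper_tail u : 0 <= u -> 1 - std_Phi u <= expR (- u ^+ 2 / 2).
Proof.
move=> u0; rewrite onem_std_Phi; apply: normal_prob_tail => // x /=.
by rewrite in_itv/= andbT => /ltW ux; rewrite expr2 ler_wpM2r.
Qed.

Lemma std_Phi_lower_tail u : 0 <= u -> std_Phi (- u) <= expR (- u ^+ 2 / 2).
Proof.
(* The tail bound is applied with centre [- u]: multiplying [x <= - u] by the nonpositive [- u]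
   reverses it. *)
move=> u0; rewrite -sqrrN; apply: normal_prob_tail => // x /=.
by rewrite in_itv/= => xu; rewrite expr2 ler_wnM2r// oppr_le0.
Qed.

(** Since [1 + z <= expR z], [expR (c * y)] exceeds [e^-1] once [c * y >= e^-1]; this dictates the
    threshold [(e * c)^-1]. *)
Lemma exists_small_expRN e c : 0 < e -> 0 < c ->
  exists2 K, 0 < K & forall y, K <= y -> expR (- (c * y)) <= e.
Proof.
move=> e0 c0; exists ((e * c)^-1); first by rewrite invr_gt0 mulr_gt0.
move=> y Ky; have y0 : 0 < y by rewrite (lt_le_trans _ Ky)// invr_gt0 mulr_gt0.
rewrite expRN invf_ple ?posrE ?expR_gt0//.
apply: (le_trans _ (expR_ge1Dx _)).
have : e^-1 <= c * y.
  by rewrite -(ler_pM2l (_ : 0 < c^-1)) ?invr_gt0// mulKf ?gt_eqF// -invfM mulrC.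
lra.
Qed.

(** A change of scale moves a large [s] far, but then [s] and [s'] lie in the same tail, where
    [std_Phi] varies by at most [e]. For bounded [s] the shift is small and [std_Phi] is Lipschitz
    with constant [peak]. Hence [d] is uniform in [s] and [s']. *)
Lemma std_Phi_rescale a e : 0 < a -> 0 < e ->
  exists2 d, 0 < d & forall a' s s', `|a' - a| <= d ->
    `|s' * a' - s * a| <= d -> `|std_Phi s' - std_Phi s| <= e.
Proof.
move=> a0 e0.
have [K0 K00 HK0] := @exists_small_expRN e 2^-1 e0 (ltac:(lra)).
(* Adding 1 ensures [K0 <= K ^+ 2], so the exponential bound applies at [y = K ^+ 2]. *)
pose K := K0 + 1; have K1 : 1 < K by rewrite /K; lra.
have HK : expR (- K ^+ 2 / 2) <= e.
  rewrite mulNr mulrC; apply: HK0; rewrite /K; nra.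
have p0 := peak_gt0.
have low x y : x <= - K -> y <= - K -> `|std_Phi x - std_Phi y| <= e.
  move=> xK yK; have := @std_Phi_lower_tail K (ltac:(lra)) => HL.
  have := std_Phi_le xK; have := std_Phi_le yK.
  have := std_Phi_ge0 x; have := std_Phi_ge0 y => *.
  by rewrite ler_norml; apply/andP; split; lra.
have high x y : K <= x -> K <= y -> `|std_Phi x - std_Phi y| <= e.
  move=> xK yK; have := @std_Phi_upper_tail K (ltac:(lra)) => HL.
  have := std_Phi_le xK; have := std_Phi_le yK.
  have := std_Phi_le1 x; have := std_Phi_le1 y => *.
  by rewrite ler_norml; apply/andP; split; lra.
have mid x y : `|x - y| * peak <= e -> `|std_Phi x - std_Phi y| <= e.
  wlog xy : x y / x <= y => [hw|].
    have [/hw//|/ltW /hw] := leP x y.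
    by rewrite distrC (distrC (std_Phi y)).
  rewrite distrC (distrC (std_Phi x)).
  rewrite !ger0_norm ?subr_ge0 ?std_Phi_le// => h.
  exact: (le_trans (std_PhiB_ub xy)).
(* The first bound keeps [a'] between [a / 2] and [3 * a / 2], so [s] beyond [2 * K + 2] forces [s']
   beyond [K]. The second serves the bounded case: there [|s' - s| * a'] is at most [d] for the
   shift plus [(2 * K + 2) * d] for the scaling, and [a' >= a / 2]. *)
pose d := Num.min (a / 2) (a * e / (2 * peak * (2 * K + 3))).
have den0 : 0 < 2 * peak * (2 * K + 3) by apply: mulr_gt0; lra.
exists d.
  rewrite lt_min; apply/andP; split; first lra.
  by rewrite divr_gt0// mulr_gt0.
move=> a' s s' ha hs.
have [dl dr] : d <= a / 2 /\ d <= a * e / (2 * peak * (2 * K + 3)).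
  by rewrite /d !ge_min !lexx orbT.
rewrite ler_pdivlMr// in dr.
have /andP[ha1 ha2] : - d <= a' - a <= d by rewrite -ler_norml.
have /andP[hs1 hs2] : - d <= s' * a' - s * a <= d by rewrite -ler_norml.
have a'0 : 0 < a' by lra.
have [sK|sK] := leP (2 * K + 2) s.
  apply: high; last lra.
  rewrite -(ler_pM2r a'0); nra.
have [sK'|sK'] := leP s (- (2 * K + 2)).
  apply: low; last lra.
  rewrite -(ler_pM2r a'0); nra.
apply: mid.
have h : `|s' - s| * a' <= d * (2 * K + 3).
  rewrite -[X in _ * X](gtr0_norm a'0) -normrM.
  have -> : (s' - s) * a' = (s' * a' - s * a) - s * (a' - a) by ring.
  apply: (le_trans (ler_normB _ _)).
  have h3 : `|s| <= 2 * K + 2 by rewrite ler_norml; apply/andP; split; lra.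
  have : `|s * (a' - a)| <= (2 * K + 2) * d by rewrite normrM ler_pM.
  move: hs; lra.
have h2 : `|s' - s| * a' * (2 * peak) <= a * e.
  apply: (le_trans _ dr); rewrite [leRHS](_ : _ = d * (2 * K + 3) * (2 * peak));
    last ring.
  by rewrite ler_pM2r// mulr_gt0.
have h3 : `|s' - s| * (a / 2) * (2 * peak) <= a * e.
  apply: (le_trans _ h2); rewrite ler_pM2r; last by rewrite mulr_gt0.
  by rewrite ler_wpM2l//; lra.
rewrite -(ler_pM2l a0); lra.
Qed.

End std_normal.

(** * The window around [sqrt (2 ln n)] in which the power of [std_Phi] jumps from 0 to 1 *)

Section window.
Set Implicit Arguments.
Unset Strict Implicit.
Context {R : realType}.
Implicit Types (u x y s a t e m : R) (n : nat).
Local Notation peak := (@normal_peak R 1).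
Local Notation b_ n := (Num.sqrt (2 * ln (n%:R : R))).

Lemma near_sqrt_2ln_ge x : \forall n \near \oo, x <= b_ n.
Proof.
near=> n.
have le_n : expR (x ^+ 2 / 2) <= n%:R :> R by near: n; exact: nbhs_infty_ger.
have n0 : 0 < n%:R :> R by rewrite (lt_le_trans _ le_n)// expR_gt0.
have h : x ^+ 2 / 2 <= ln (n%:R : R).
  by rewrite -[leLHS]expRK ler_ln// posrE expR_gt0.
rewrite (le_trans (ler_norm x))// -sqrtr_sqr ler_wsqrtr//; lra.
Unshelve. all: by end_near. Qed.

(** This identity is what singles out [b_ n]: the Gaussian factor there exactly cancels the exponent
    [n]. *)
Lemma natr_expRN_sqrt_2ln n : (0 < n)%N ->
  n%:R * expR (- b_ n ^+ 2 / 2) = 1 :> R.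
Proof.
move=> n0; have n1 : 1 <= n%:R :> R by rewrite ler1n.
rewrite sqr_sqrtr; last by rewrite mulr_ge0// ln_ge0.
rewrite mulNr mulrAC divff ?mul1r ?pnatr_eq0// expRN lnK ?posrE ?divff//; lra.
Qed.

Lemma bernoulli_onem x n : 0 <= x <= 1 -> 1 - n%:R * (1 - x) <= x ^+ n.
Proof.
move=> /andP[x0 x1]; elim: n => [|n IH]; first by rewrite expr0; lra.
rewrite exprS -natr1.
have h : 0 <= n%:R :> R by [].
have := mulr_ge0 h (sqr_ge0 (1 - x)); have := ler_wpM2l x0 IH; lra.
Qed.

(** The inequality [1 + z <= expR z] at [z = x - 1], raised to the power [n]. *)
Lemma expr_le_expRN x n : 0 <= x -> x ^+ n <= expR (- (n%:R * (1 - x))).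
Proof.
move=> x0; rewrite -mulrN mulrC expRM_natr lerXn2r ?nnegrE ?expR_ge0//.
by apply: (le_trans _ (expR_ge1Dx _)); lra.
Qed.

(** By Bernoulli the defect from 1 is at most [n] times the upper tail at [b_ n + t]. Expanding the
    square leaves at most [expR (- (t * b_ n))], which vanishes as [b_ n] grows. *)
Lemma near_std_Phi_expn_hi t e : 0 < t -> 0 < e ->
  \forall n \near \oo, 1 - e <= std_Phi (b_ n + t) ^+ n.
Proof.
move=> t0 e0; have [K K0 HK] := exists_small_expRN e0 t0.
near=> n.
have bK : K <= b_ n by near: n; exact: near_sqrt_2ln_ge.
have n0 : (0 < n)%N by near: n; exact: nbhs_infty_gt.
have := bernoulli_onem n (x := std_Phi (b_ n + t)).
rewrite std_Phi_ge0 std_Phi_le1 => /(_ isT); apply: le_trans.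
rewrite lerD2l lerN2; apply: le_trans (HK _ bK).
have bt0 : 0 <= b_ n + t by rewrite addr_ge0// ltW.
apply: (@le_trans _ _ (n%:R * expR (- (b_ n + t) ^+ 2 / 2))).
  by rewrite ler_wpM2l// std_Phi_upper_tail.
apply: (@le_trans _ _ (n%:R * (expR (- b_ n ^+ 2 / 2) * expR (- (t * b_ n))))).
  rewrite ler_wpM2l// -expRD ler_expR; nra.
by rewrite mulrA natr_expRN_sqrt_2ln// mul1r.
Unshelve. all: by end_near. Qed.

(** The tail beyond [b_ n - t] contains an interval of length [t / 2] ending at [b_ n - t / 2].
    Times [n], its mass is at least a constant times [expR (t / 2 * b_ n)], which is unbounded, so
    the power tends to 0. *)
Lemma near_std_Phi_expn_lo t e : 0 < t -> 0 < e ->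
  \forall n \near \oo, std_Phi (b_ n - t) ^+ n <= e.
Proof.
(* The last factor [t / 2] of [c] comes from bounding [expR (t / 2 * b_ n)] below by [t / 2 * b_ n];
   the others are the constants left after completing the square. *)
move=> t0 e0; pose c := t / 2 * peak * expR (- t ^+ 2 / 8) * (t / 2).
have c0 : 0 < c by rewrite !mulr_gt0 ?peak_gt0 ?expR_gt0 ?invr_gt0.
have [K K0 HK] := exists_small_expRN e0 c0.
near=> n.
have bK : K <= b_ n by near: n; exact: near_sqrt_2ln_ge.
(* This keeps the interval in the nonnegative half-line, where the density decreases. *)
have bt : t <= b_ n by near: n; exact: near_sqrt_2ln_ge.
have n0 : (0 < n)%N by near: n; exact: nbhs_infty_gt.
apply: (le_trans (expr_le_expRN n (std_Phi_ge0 _))).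
apply: le_trans (HK _ bK); rewrite ler_expR lerN2.
have lb : t / 2 * std_phi (b_ n - t / 2) <= 1 - std_Phi (b_ n - t).
  have := @std_PhiB_lb R (b_ n - t) (b_ n - t / 2).
  have -> : b_ n - t / 2 - (b_ n - t) = t / 2 by lra.
  have -> : 0 <= b_ n - t <= b_ n - t / 2 by apply/andP; split; lra.
  move=> /(_ isT) h; have := std_Phi_le1 (b_ n - t / 2); lra.
apply: (@le_trans _ _ (n%:R * (t / 2 * std_phi (b_ n - t / 2)))); last first.
  by rewrite ler_wpM2l.
rewrite std_phiE.
have -> : - (b_ n - t / 2) ^+ 2 / 2
    = - b_ n ^+ 2 / 2 + (- t ^+ 2 / 8 + t / 2 * b_ n) by field.
rewrite expRD [leRHS](_ : _ = n%:R * expR (- b_ n ^+ 2 / 2) *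
  (t / 2 * peak * expR (- t ^+ 2 / 8 + t / 2 * b_ n))); last ring.
rewrite natr_expRN_sqrt_2ln// mul1r expRD mulrA /c -!mulrA.
rewrite !(ler_pM2l t0) !ler_pM2l ?peak_gt0 ?expR_gt0 ?invr_gt0//.
by apply: (le_trans _ (expR_ge1Dx _)); lra.
Unshelve. all: by end_near. Qed.

End window.

(** * Comparison of the integrals through the points where the affine argument crosses the window *)

Section comparison.
Set Implicit Arguments.
Unset Strict Implicit.
Context {R : realType}.
Implicit Types (f : R -> R) (l u x y s a b c d t e m : R) (n : nat).
Local Notation mu := (@lebesgue_measure R).
Local Notation b_ n := (Num.sqrt (2 * ln (n%:R : R))).

Lemma integrable_bounded_std_phi f c : measurable_fun setT f ->
  (forall x, `|f x| <= c) ->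
  mu.-integrable setT (EFin \o (fun x => f x * std_phi x)).
Proof.
move=> mf fc.
apply: (@le_integrable _ _ _ mu setT _ _ (fun x => c%:E * (std_phi x)%:E)%E) => //.
- apply/measurable_EFinP; apply: measurable_funM => //.
  exact: measurable_normal_pdf.
- move=> x _ /=; rewrite lee_fin !normrM ler_wpM2r//.
  by rewrite (le_trans (fc x))// ler_norm.
- by apply: integrableZl => //; exact: integrable_std_phi.
Qed.

Lemma Rintegral_std_phi : \int[mu]_x std_phi x = 1 :> R.
Proof. by rewrite /Rintegral integral_normal_pdf. Qed.

Lemma Rintegral_indic_std_phi s :
  \int[mu]_x (\1_`]s, +oo[ x * std_phi x) = 1 - std_Phi s.
Proof.
rewrite onem_std_Phi /normal_prob /Rintegral [in RHS]integral_mkcond; congr fine.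
apply: eq_integral => x _; rewrite patchE indicE.
by case: ifP; rewrite ?mul1r ?mul0r.
Qed.

Lemma measurable_mono_affine f a b m : {homo f : x y / x <= y} ->
  measurable_fun setT (fun x => f ((x * a + m) / b)).
Proof.
move=> fh; apply: (measurableT_comp (f := f)).
  exact: nondecreasing_measurable.
apply: measurable_funM => //; apply: measurable_funD => //.
exact: measurable_funM.
Qed.

Lemma integrable_mono_affine f a b m : {homo f : x y / x <= y} ->
  (forall x, 0 <= f x <= 1) ->
  mu.-integrable setT (EFin \o (fun x => f ((x * a + m) / b) * std_phi x)).
Proof.
move=> fh f01; apply: (integrable_bounded_std_phi (c := 1)).
  exact: measurable_mono_affine.
by move=> x; have /andP[f0 f1] := f01 ((x * a + m) / b); rewrite ger0_norm.
Qed.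

(** The argument reaches [l] at [x = (b * l - m) / a]. Right of this point [f] is at most 1, left of
    it at most [f l <= e], so the indicator of the right half-line plus [e] dominates. *)
Lemma Rintegral_mono_affine_le f l a b m e : {homo f : x y / x <= y} ->
  (forall x, 0 <= f x <= 1) -> 0 < a -> 0 < b -> f l <= e ->
  \int[mu]_x (f ((x * a + m) / b) * std_phi x) <= 1 - std_Phi ((b * l - m) / a) + e.
Proof.
move=> fh f01 a0 b0 fl; set s := (b * l - m) / a.
have i1 : mu.-integrable setT (EFin \o (fun x => \1_`]s, +oo[ x * std_phi x)).
  apply: (integrable_bounded_std_phi (c := 1)) => // x.
  by rewrite indicE; case: (_ \in _); rewrite ?normr1 ?normr0.
have i2 : mu.-integrable setT (EFin \o (fun x => e * std_phi x)).
  exact: (integrable_bounded_std_phi (c := `|e|)).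
(* Both terms of the bound become integrals against the density, of total mass 1, so a pointwise
   comparison suffices. *)
rewrite -Rintegral_indic_std_phi -[X in _ + X]mulr1 -Rintegral_std_phi.
rewrite -RintegralZl//; last exact: integrable_std_phi.
rewrite -RintegralD//; apply: le_Rintegral => //.
- exact: integrable_mono_affine.
- exact: (integrableD measurableT i1 i2).
move=> x _; rewrite -mulrDl ler_wpM2r ?std_phi_ge0//.
have e0 : 0 <= e by apply: le_trans fl; case/andP: (f01 l).
rewrite indicE; have [xs|xs] := boolP (x \in `]s, +oo[%classic).
  by have /andP[_ h] := f01 ((x * a + m) / b); rewrite /=; lra.
rewrite /= add0r (le_trans _ fl)// fh//.
move: xs; rewrite notin_setE/= in_itv/= andbT => /negP; rewrite -leNgt => xs.
by rewrite ler_pdivrMr// [leRHS]mulrC -lerBrDr -ler_pdivlMr.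
Qed.

(** Mirror image of the upper bound: right of the crossing of [u] the function is at least [1 - e],
    and left of it at least [0 >= - e]. *)
Lemma Rintegral_mono_affine_ge f u a b m e : {homo f : x y / x <= y} ->
  (forall x, 0 <= f x <= 1) -> 0 < a -> 0 < b -> 1 - e <= f u ->
  1 - std_Phi ((b * u - m) / a) - e <= \int[mu]_x (f ((x * a + m) / b) * std_phi x).
Proof.
move=> fh f01 a0 b0 fu; set s := (b * u - m) / a.
have i1 : mu.-integrable setT (EFin \o (fun x => \1_`]s, +oo[ x * std_phi x)).
  apply: (integrable_bounded_std_phi (c := 1)) => // x.
  by rewrite indicE; case: (_ \in _); rewrite ?normr1 ?normr0.
have i2 : mu.-integrable setT (EFin \o (fun x => e * std_phi x)).
  exact: (integrable_bounded_std_phi (c := `|e|)).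
rewrite -Rintegral_indic_std_phi -[X in _ - X]mulr1 -Rintegral_std_phi.
rewrite -RintegralZl//; last exact: integrable_std_phi.
rewrite -RintegralB//; apply: le_Rintegral => //.
- exact: (integrableB measurableT i1 i2).
- exact: integrable_mono_affine.
move=> x _; rewrite -mulrBl ler_wpM2r ?std_phi_ge0//.
have e0 : 0 <= e by case/andP: (f01 u) => _ h; lra.
rewrite indicE; have [xs|xs] := boolP (x \in `]s, +oo[%classic); last first.
  by have /andP[h _] := f01 ((x * a + m) / b); rewrite /=; lra.
rewrite /= (le_trans fu)// fh//.
move: xs; rewrite inE/= in_itv/= andbT => /ltW xs.
by rewrite ler_pdivlMr// [leLHS]mulrC -lerBlDr -ler_pdivrMr.
Qed.

(** Here [m] cancels, which makes the final estimate uniform in the maximum. The sign of [t] is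
    free, so both pairings of a lower with an upper crossing are covered. *)
Lemma dist_crossing_le b b' c t d m : 0 <= b -> b <= 1 -> 0 <= b' -> b' <= 1 ->
  `|c * (b - b')| <= d / 2 -> `|t| <= d / 4 ->
  `|b' * (c + t) - m - (b * (c - t) - m)| <= d.
Proof.
move=> b0 b1 b'0 b'1 hc ht.
have -> : b' * (c + t) - m - (b * (c - t) - m) = (b + b') * t - c * (b - b') by ring.
apply: (le_trans (ler_normB _ _)).
have : `|(b + b') * t| <= 2 * (d / 4).
  by rewrite normrM ler_pM// ger0_norm ?addr_ge0//; lra.
move: hc; lra.
Qed.

(** The upper bound on one integral is set against the lower bound on the other: each contributes an
    error [e], and the gap between their crossings a third. *)
Lemma dist_sandwich_le (I1 I2 p1 p2 q1 q2 e : R) :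
  I1 <= 1 - p1 + e -> 1 - q1 - e <= I1 -> I2 <= 1 - p2 + e -> 1 - q2 - e <= I2 ->
  `|q2 - p1| <= e -> `|p2 - q1| <= e -> `|I1 - I2| <= e * 3.
Proof.
move=> h1 h2 h3 h4; rewrite !ler_norml => /andP[? ?] /andP[? ?].
by apply/andP; split; lra.
Qed.

(** Both [d] and the rank of [n] are fixed before [m], [a'] and [b'], so the bound can be used at
    each sample point with the random maximum and the random estimate. *)
Lemma near_Rintegral_expn_stable a b e : 0 < a -> 0 < b -> b <= 1 -> 0 < e ->
  exists2 d, 0 < d & \forall n \near \oo, forall m a' b',
    0 < b' -> b' <= 1 -> `|a' - a| <= d -> `|b_ n * (b - b')| <= d ->
    `| \int[mu]_x (std_Phi ((x * a + m) / b) ^+ n * std_phi x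
        - std_Phi ((x * a' + m) / b') ^+ n * std_phi x) | <= e.
Proof.
move=> a0 b0 b1 e0.
have e3 : 0 < e / 3 by lra.
have [d0 d00 Hd0] := std_Phi_rescale a0 e3.
(* Half of the tolerance [d0] goes to [b_ n * (b - b')]. The other half goes to the window:
   [t = d0 / 4] is multiplied by [b + b' <= 2]. The bound [a / 2] keeps [a'] positive. *)
pose d := Num.min (d0 / 2) (a / 2).
have [dd0 da] : d <= d0 / 2 /\ d <= a / 2 by rewrite /d !ge_min !lexx orbT.
exists d; first by rewrite lt_min; apply/andP; split; lra.
pose t := d0 / 4; have t0 : 0 < t by rewrite /t; lra.
near=> n => m a' b' b'0 b'1 ha hb.
have lo : std_Phi (b_ n - t) ^+ n <= e / 3.
  by near: n; exact: near_std_Phi_expn_lo.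
have hi : 1 - e / 3 <= std_Phi (b_ n + t) ^+ n.
  by near: n; exact: near_std_Phi_expn_hi.
pose f x := std_Phi x ^+ n : R.
have fh : {homo f : x y / x <= y}.
  by move=> x y xy; rewrite lerXn2r ?nnegrE ?std_Phi_ge0// std_Phi_le.
have f01 x : 0 <= f x <= 1.
  by rewrite exprn_ge0 ?std_Phi_ge0// exprn_ile1 ?std_Phi_ge0 ?std_Phi_le1.
have /andP[ha1 ha2] : - d <= a' - a <= d by rewrite -ler_norml.
have /andP[hb1 hb2] : - d <= b_ n * (b - b') <= d by rewrite -ler_norml.
have a'0 : 0 < a' by lra.
have ha0 : `|a' - a| <= d0 by rewrite (le_trans ha)//; lra.
have i1 := integrable_mono_affine a b m fh f01.
have i2 := integrable_mono_affine a' b' m fh f01.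
have -> := RintegralB measurableT i1 i2.
have L1 := Rintegral_mono_affine_le m fh f01 a0 b0 lo.
have L2 := Rintegral_mono_affine_le m fh f01 a'0 b'0 lo.
have U1 := Rintegral_mono_affine_ge m fh f01 a0 b0 hi.
have U2 := Rintegral_mono_affine_ge m fh f01 a'0 b'0 hi.
have shift := dist_crossing_le m (ltW b0) b1 (ltW b'0) b'1.
have hb0 : `|b_ n * (b - b')| <= d0 / 2 by exact: le_trans dd0.
have C1 : `|std_Phi ((b' * (b_ n + t) - m) / a') - std_Phi ((b * (b_ n - t) - m) / a)|
    <= e / 3.
  by apply: Hd0 ha0 _; rewrite !divfK ?gt_eqF// shift// gtr0_norm.
have C2 : `|std_Phi ((b' * (b_ n - t) - m) / a') - std_Phi ((b * (b_ n + t) - m) / a)|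
    <= e / 3.
  (* Writing [t] as [- (- t)] lets the shift estimate apply with [- t] in place of [t]. *)
  apply: Hd0 ha0 _; rewrite !divfK ?gt_eqF// -[X in b * (_ + X)]opprK.
  by rewrite shift// normrN gtr0_norm.
rewrite (le_trans (dist_sandwich_le L1 U1 L2 U2 C1 C2))//.
by rewrite divfK// pnatr_eq0.
Unshelve. all: by end_near. Qed.

End comparison.

(** * Measurability in the sample point and transfer of convergence in probability *)

Section measurability.
Set Implicit Arguments.
Unset Strict Implicit.
Context {R : realType} {d : measure_display} {T : measurableType d}.
Implicit Types (g h : T -> R).
Local Notation mu := (@lebesgue_measure R).

Lemma measurable_sqrt g : measurable_fun setT g ->
  measurable_fun setT (fun w => Num.sqrt (g w)).
Proof.
move=> mg; apply: (measurableT_comp _ mg).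
by apply: nondecreasing_measurable => // x y; exact: ler_wsqrtr.
Qed.

Lemma measurable_inv_pos g : measurable_fun setT g -> (forall w, 0 < g w) ->
  measurable_fun setT (fun w => (g w)^-1).
Proof.
move=> mg g0; rewrite (_ : (fun w => _) = (fun w => g w `^ (-1))); last first.
  by apply/funext => w; rewrite powR_inv1// ltW.
exact: (measurableT_comp (measurable_powR _) mg).
Qed.

Lemma measurable_Mn n (X : 'I_n -> T -> R) :
  (forall i, measurable_fun setT (X i)) ->
  measurable_fun setT (fun w => Mn (fun i => X i w)).
Proof.
move=> mX; apply: (measurableT_comp (f := fine)); first exact: fine_measurable.
(* The enumeration is generalized to an arbitrary list, so that the maximum is built one term at a
   time. *)
elim: (index_enum _) => [|i s IH].
  rewrite (_ : (fun w => _) = cst -oo%E); first exact: measurable_cst.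
  by apply/funext => w; rewrite big_nil.
rewrite (_ : (fun w => _) = (fun w => maxe (X i w)%:E
    (\big[maxe/-oo%E]_(j <- s) (X j w)%:E))); last first.
  by apply/funext => w; rewrite big_cons.
by apply: measurable_maxe => //; apply/measurable_EFinP.
Qed.

(** The integrand is jointly measurable in [(w, x)] and nonnegative, so Tonelli makes its partial
    integral over [x] measurable in [w]. *)
Lemma measurable_Rintegral_mono_affine (f : R -> R) (a b m : T -> R) :
  {homo f : x y / x <= y} -> (forall x, 0 <= f x) ->
  measurable_fun setT a -> measurable_fun setT b -> (forall w, 0 < b w) ->
  measurable_fun setT m ->
  measurable_fun setT
    (fun w => \int[mu]_x (f ((x * a w + m w) / b w) * std_phi x)).
Proof.
move=> fh f0 ma mb b0 mm; apply: (measurableT_comp (f := fine)).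
  exact: fine_measurable.
pose F (z : T * R) := ((f ((z.2 * a z.1 + m z.1) / b z.1) * std_phi z.2)%:E)%E.
apply: (measurable_fun_fubini_tonelli_F (m2 := mu) F); last first.
  by move=> z; rewrite lee_fin mulr_ge0// std_phi_ge0.
apply/measurable_EFinP; apply: measurable_funM; last first.
  by apply: (measurableT_comp (measurable_normal_pdf 0 1)).
apply: (measurableT_comp (f := f)); first exact: nondecreasing_measurable.
apply: measurable_funM; last first.
  exact: (measurableT_comp (measurable_inv_pos mb b0)).
apply: measurable_funD; last exact: (measurableT_comp mm).
by apply: measurable_funM => //; exact: (measurableT_comp ma).
Qed.

Lemma measurable_normr_gt g e : measurable_fun setT g ->
  measurable [set w | e < `|g w|].
Proof.
move=> mg; have mng : measurable_fun setT (fun w => `|g w|).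
  exact: measurableT_comp.
rewrite (_ : [set w | _] = setT `&` (fun w => `|g w|) @^-1` `]e, +oo[).
  exact: mng.
by rewrite setTI; apply/seteqP; split => w /=; rewrite in_itv/= andbT.
Qed.

(** Eventually the event that [Y] exceeds [e] is contained in the event that [Z] exceeds [r], so its
    probability is squeezed to 0. *)
Lemma cvg_prob0_near (P : probability T R) (Y Z : nat -> T -> R) :
  (forall n, measurable_fun setT (Y n)) -> (forall n, measurable_fun setT (Z n)) ->
  (forall e, 0 < e -> exists2 r, 0 < r &
    \forall n \near \oo, forall w, `|Z n w| <= r -> `|Y n w| <= e) ->
  cvg_prob0 P Z -> cvg_prob0 P Y.
Proof.
move=> mY mZ HYZ cZ e e0; have [r r0 Hr] := HYZ e e0.
apply: (@squeeze_cvge _ _ _ _ (cst 0%E) _ (fun n => P [set w | r < `|Z n w|]));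
  [|exact: cvg_cst|exact: cZ].
near=> n; rewrite measure_ge0/=; apply: le_measure.
- by rewrite inE; exact: measurable_normr_gt.
- by rewrite inE; exact: measurable_normr_gt.
move=> w /=; rewrite !ltNge; apply: contra.
exact: (near Hr n).
Unshelve. all: by end_near. Qed.

End measurability.

(** The assumption on the estimator controls only square roots of [1 - r]; this recovers those of
    [r]. From [a ^+ 2 + b ^+ 2 = a' ^+ 2 + b' ^+ 2] one gets [(a' - a) * (a' + a) = (b - b') * (b +
    b')], where [b + b' <= 2] and [a' + a >= a > 0]. *)
Lemma dist_sqrt_onem_le {R : realType} (r s d : R) : 0 < r <= 1 -> 0 <= s <= 1 ->
  `|Num.sqrt (1 - r) - Num.sqrt (1 - s)| <= Num.sqrt r * d / 2 ->
  `|Num.sqrt s - Num.sqrt r| <= d.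
Proof.
move=> /andP[r0 r1] /andP[s0 s1].
set a := Num.sqrt r; set a' := Num.sqrt s.
set b := Num.sqrt (1 - r); set b' := Num.sqrt (1 - s) => h.
have a0 : 0 < a by rewrite sqrtr_gt0.
have a'0 : 0 <= a' by exact: sqrtr_ge0.
have b0 : 0 <= b by exact: sqrtr_ge0.
have b'0 : 0 <= b' by exact: sqrtr_ge0.
have aE : a ^+ 2 = r by rewrite sqr_sqrtr ?ltW.
have a'E : a' ^+ 2 = s by rewrite sqr_sqrtr.
have bE : b ^+ 2 = 1 - r by rewrite sqr_sqrtr// subr_ge0.
have b'E : b' ^+ 2 = 1 - s by rewrite sqr_sqrtr// subr_ge0.
have b1 : b <= 1 by rewrite -(@expr_le1 _ 2)// bE; lra.
have b'1 : b' <= 1 by rewrite -(@expr_le1 _ 2)// b'E; lra.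
have E : (a' - a) * (a' + a) = (b - b') * (b + b').
  by rewrite -!subr_sqr aE a'E bE b'E; ring.
have h1 : `|a' - a| * (a' + a) <= a * d.
  rewrite -[X in _ * X]ger0_norm ?addr_ge0 ?(ltW a0)// -normrM E normrM.
  rewrite [`|b + b'|]ger0_norm ?addr_ge0//.
  apply: (@le_trans _ _ (a * d / 2 * 2)); last by rewrite divfK// pnatr_eq0.
  by rewrite ler_pM// ?addr_ge0//; lra.
rewrite -(ler_pM2l a0) (le_trans _ h1)// mulrC ler_wpM2l//.
by rewrite lerDr.
Qed.

Theorem theorem3 (R : realType) (rho : R) (d : measure_display)
  (T : measurableType d) (P : probability T R)
  (X : forall n : nat, 'I_n -> T -> R)
  (rhohat : forall n : nat, ('I_n -> R) -> R) :
  0 < rho < 1 ->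
  (forall n i, measurable_fun [set: T] (X n i)) ->
  (forall n, jointly_normal0 P (X n) (@equicorr R n rho)) ->
  (forall n, measurable_fun [set: T] (fun w => rhohat n (fun i => X n i w))) ->
  (forall n x, 0 <= rhohat n x < 1) ->
  cvg_prob0 P (fun n w => Num.sqrt (2 * ln (n%:R)) *
      (Num.sqrt (1 - rho) - Num.sqrt (1 - rhohat n (fun i => X n i w)))) ->
  cvg_prob0 P (fun n w =>
      `| \int[lebesgue_measure]_(x in [set: R])
           (std_Phi ((x * Num.sqrt rho + Mn (fun i => X n i w))
                       / Num.sqrt (1 - rho)) ^+ n * std_phi x
          - std_Phi ((x * Num.sqrt (rhohat n (fun i => X n i w))
                       + Mn (fun i => X n i w))
                       / Num.sqrt (1 - rhohat n (fun i => X n i w))) ^+ n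
            * std_phi x) |).
Proof.
move=> /andP[r0 r1] mX _ mrh rh01 hcvg.
have br0 n w : 0 < Num.sqrt (1 - rhohat n (fun i => X n i w)).
  by rewrite sqrtr_gt0 subr_gt0; case/andP: (rh01 n (fun i => X n i w)).
have b0 : 0 < Num.sqrt (1 - rho) by rewrite sqrtr_gt0 subr_gt0.
have a0 : 0 < Num.sqrt rho by rewrite sqrtr_gt0.
have sqrt_le1 (x : R) : 0 <= x -> Num.sqrt (1 - x) <= 1.
  by move=> x0; rewrite -[leRHS]sqrtr1 ler_wsqrtr// gerBl.
have mbr n : measurable_fun [set: T]
    (fun w => Num.sqrt (1 - rhohat n (fun i => X n i w))).
  by apply: measurable_sqrt; apply: measurable_funB.
(* Beyond measurability, what remains is a deterministic implication at each sample point. *)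
apply: (cvg_prob0_near _ _ _ hcvg).
- move=> n; apply: measurableT_comp => //=.
  pose f x := (std_Phi x ^+ n : R).
  have fh : {homo f : x y / x <= y}.
    by move=> x y xy; rewrite lerXn2r ?nnegrE ?std_Phi_ge0// std_Phi_le.
  have f01 x : 0 <= f x <= 1.
    by rewrite exprn_ge0 ?std_Phi_ge0// exprn_ile1 ?std_Phi_ge0 ?std_Phi_le1.
  have f0 x : 0 <= f x by case/andP: (f01 x).
  pose I (a b m : R) := \int[lebesgue_measure]_x (f ((x * a + m) / b) * std_phi x).
  pose s w := rhohat n (fun i => X n i w).
  pose m w := Mn (fun i => X n i w).
  (* Splitting the integral of the difference leaves two nonnegative integrands, as Tonelli
     requires. *)
  rewrite (_ : (fun w => _) = (fun w => I (Num.sqrt rho) (Num.sqrt (1 - rho)) (m w)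
      - I (Num.sqrt (s w)) (Num.sqrt (1 - s w)) (m w))); last first.
    apply/funext => w.
    by apply: (RintegralB measurableT); exact: (integrable_mono_affine _ _ _ fh f01).
  apply: measurable_funB; apply: measurable_Rintegral_mono_affine => //.
  + exact: measurable_Mn.
  + exact: (measurable_sqrt (mrh n)).
  + exact: (mbr n).
  + exact: br0.
  + exact: measurable_Mn.
- by move=> n; apply: measurable_funM => //; exact: measurable_funB.
move=> e e0.
have [d1 d10 Hd1] := near_Rintegral_expn_stable a0 b0 (sqrt_le1 _ (ltW r0)) e0.
(* The first bound controls [b_n * (b - b')], the second the difference of [Num.sqrt rho] and its
   estimate. *)
pose r := Num.min d1 (Num.sqrt rho * d1 / 2).
have [rd1 rd2] : r <= d1 /\ r <= Num.sqrt rho * d1 / 2.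
  by rewrite /r !ge_min !lexx orbT.
exists r; first by rewrite lt_min d10/= divr_gt0// mulr_gt0.
near=> n => w hw.
(* With this factor at least 1, the scaled hypothesis also bounds the unscaled difference of square
   roots. *)
have bn1 : 1 <= Num.sqrt (2 * ln (n%:R : R)).
  by near: n; exact: near_sqrt_2ln_ge.
have /andP[s0 s1] := rh01 n (fun i => X n i w).
rewrite normr_id.
have := near Hd1 n; apply => //.
- exact: sqrt_le1.
- apply: dist_sqrt_onem_le; [by rewrite r0 ltW|by rewrite s0 ltW|].
  apply: le_trans rd2; apply: le_trans hw.
  by rewrite normrM ler_peMl// ger0_norm ?sqrtr_ge0.
- exact: le_trans rd1.
Unshelve. all: by end_near. Qed.
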